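(* Let $M^n$ $(n\ge 2)$ be a hypercylinder over a unit speed planar curve $\gamma(s)\subset\mathbb{E}^2\subset\mathbb{E}^{n+1}$. Then the canonical vector field of $M^n$ is incompressible if and only if, up to rotations of $\mathbb{E}^2$ about the origin of $\mathbb{E}^2$, $M^n$ is an open part of the hypersurface defined by $$\Big((1-n)s\cos(K(s))+\sqrt{n(n-1)}\sqrt{c^2-s^2}\,\sin(K(s)),\ (1-n)s\sin(K(s))-\sqrt{n(n-1)}\sqrt{c^2-s^2}\,\cos(K(s)),\ t_2,\ldots,t_n\Big)$$ for some real number $c>0$, where $K(s)=\frac{\sqrt{n}}{\sqrt{n-1}}\arctan\!\left(\frac{s}{\sqrt{c^2-s^2}}\right)$ with $-c<s<c$.
   Context: The hypercylinder over a unit speed planar curve $\gamma(s)$ in $\mathbb{E}^2\subset\mathbb{E}^{n+1}=\mathbb{E}^2\times\mathbb{E}^{n-1}$ (with $\mathbb{E}^2$ the plane of the first two coordinates) is the hypersurface parametrized by $\mathbf{x}(s,t_2,\ldots,t_n)=(\gamma(s),t_2,\ldots,t_n)$, with $t_2,\dots,t_n$ real parameters. The position vector field $\mathbf{x}$ of a submanifold of Euclidean space (relative to the origin) decomposes as $\mathbf{x}=\mathbf{x}^T+\mathbf{x}^N$ into tangential and normal components; $\mathbf{x}^T$ is called the canonical vector field. A vector field on a Riemannian manifold is incompressible if its divergence vanishes at all points. Rotations of $\mathbb{E}^2$ act on the first two coordinates of $\mathbb{E}^{n+1}$. The arclength parameter $s$ of $\gamma$ is considered up to translation and reversal. *)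

(* Defs.v *)
From HB Require Import structures.
From mathcomp Require Import all_boot all_order all_algebra.
From mathcomp Require Import all_classical all_reals all_analysis.
Set Implicit Arguments.
Unset Strict Implicit.
Unset Printing Implicit Defensive.
Import Order.TTheory GRing.Theory Num.Theory.
Import numFieldNormedType.Exports.
Local Open Scope classical_set_scope.
Local Open Scope ring_scope.

(* The library norm `|u| on 'rV[R]_q is the sup norm; Euclidean geometry goes
   through this inner product instead. *)
Definition dot (R : realType) (q : nat) (u v : 'rV[R]_q) : R :=
  \sum_(k < q) u 0 k * v 0 k.

Definition partial (R : realType) (p : nat) (V : normedModType R)
    (f : 'rV[R]_p -> V) (i : 'I_p) (u : 'rV[R]_p) : V :=
  'D_(delta_mx 0 i) f u.

Section RiemannianGeometry.
Variables (R : realType) (p : nat).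

(* Metrics and vector fields on an open subset of R^p are given by their
   components in the coordinate frame. *)
Implicit Types (g : 'rV[R]_p -> 'M[R]_p) (V : 'rV[R]_p -> 'rV[R]_p).

Definition christoffel g (k i j : 'I_p) (u : 'rV[R]_p) : R :=
  2^-1 * \sum_(l < p) invmx (g u) k l *
    (partial (fun v => g v j l) i u + partial (fun v => g v i l) j u
     - partial (fun v => g v i j) l u).

(* k-th component of the Levi-Civita derivative of V along the i-th
   coordinate field *)
Definition covariant_deriv g V (i k : 'I_p) (u : 'rV[R]_p) : R :=
  partial (fun v => V v 0 k) i u
  + \sum_(j < p) christoffel g k i j u * V u 0 j.

Definition divergence g V (u : 'rV[R]_p) : R :=
  \sum_(i < p) covariant_deriv g V i i u.

Definition incompressible g V (D : set 'rV[R]_p) : Prop :=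
  forall u, D u -> divergence g V u = 0.

End RiemannianGeometry.

Section Submanifold.
Variables (R : realType) (p q : nat) (x : 'rV[R]_p -> 'rV[R]_q).

Definition induced_metric (u : 'rV[R]_p) : 'M[R]_p :=
  \matrix_(i, j) dot (partial x i u) (partial x j u).

(* Components, in the frame of the partial derivatives of x, of the orthogonal
   projection of w onto the tangent space at u; see normal_component_orthogonal
   below. *)
Definition tangential_component (u : 'rV[R]_p) (w : 'rV[R]_q) : 'rV[R]_p :=
  (\row_j dot w (partial x j u)) *m invmx (induced_metric u).

Definition canonical_field (u : 'rV[R]_p) : 'rV[R]_p :=
  tangential_component u (x u).

Lemma normal_component_orthogonal (u : 'rV[R]_p) (w : 'rV[R]_q) (j : 'I_p) :
  induced_metric u \in unitmx ->
  dot (w - \sum_(i < p) tangential_component u w 0 i *: partial x i u)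
      (partial x j u) = 0.
Proof.
move=> gU.
have dotBl (a b c : 'rV[R]_q) : dot (a - b) c = dot a c - dot b c.
  rewrite /dot -sumrB; apply: eq_bigr => k _.
  by rewrite !mxE mulrBl.
have dotS : dot (\sum_(i < p) tangential_component u w 0 i *: partial x i u)
              (partial x j u)
        = (tangential_component u w *m induced_metric u) 0 j.
  rewrite mxE /dot.
  under eq_bigr => k _ do rewrite summxE mulr_suml.
  rewrite exchange_big; apply: eq_bigr => i _; rewrite !mxE mulr_sumr.
  by apply: eq_bigr => k _; rewrite !mxE mulrA.
by rewrite dotBl dotS /tangential_component mulmxKV // mxE subrr.
Qed.

End Submanifold.

Section Hypercylinder.
Variables (R : realType) (n : nat).

(* E^{n+1} = E^2 x E^{n-1} is 'rV_(2 + n.-1), and parameter space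
   {(s, t_2, ..., t_n)} is 'rV_(1 + n.-1). *)
Definition arclength (u : 'rV[R]_(1 + n.-1)) : R := u 0 0.

Definition hypercylinder (gamma : R -> 'rV[R]_2) (u : 'rV[R]_(1 + n.-1)) :
    'rV[R]_(2 + n.-1) :=
  row_mx (gamma (arclength u)) (rsubmx u).

Definition cylinder_domain (I : set R) : set 'rV[R]_(1 + n.-1) :=
  [set u | I (arclength u)].

(* The substitution s |-> e * s + b; for e = 1 or -1 it is a translation of the
   arclength parameter, possibly composed with a reversal. *)
Definition change_arclength (e b : R) (u : 'rV[R]_(1 + n.-1)) :
    'rV[R]_(1 + n.-1) :=
  row_mx (e * arclength u + b)%:M (rsubmx u).

Definition rotate_plane (A : 'M[R]_2) (p : 'rV[R]_(2 + n.-1)) :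
    'rV[R]_(2 + n.-1) :=
  row_mx (lsubmx p *m A) (rsubmx p).

Definition Kfun (c s : R) : R :=
  Num.sqrt n%:R / Num.sqrt (n%:R - 1) * atan (s / Num.sqrt (c ^+ 2 - s ^+ 2)).

Definition model_curve (c s : R) : 'rV[R]_2 :=
  let r := Num.sqrt (n%:R * (n%:R - 1)) * Num.sqrt (c ^+ 2 - s ^+ 2) in
  row_mx ((1 - n%:R) * s * cos (Kfun c s) + r * sin (Kfun c s))%:M
         ((1 - n%:R) * s * sin (Kfun c s) - r * cos (Kfun c s))%:M.

Definition model_hypersurface (c : R) : 'rV[R]_(1 + n.-1) -> 'rV[R]_(2 + n.-1) :=
  hypercylinder (model_curve c).

End Hypercylinder.

Definition is_rotation (R : realType) (A : 'M[R]_2) : Prop :=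
  A *m A^T = 1%:M /\ \det A = 1.

Definition unit_speed (R : realType) (I : set R) (gamma : R -> 'rV[R]_2) : Prop :=
  forall s, I s -> dot (derive1 gamma s) (derive1 gamma s) = 1.

Definition twice_derivable (R : realType) (I : set R) (gamma : R -> 'rV[R]_2) :
    Prop :=
  forall s, I s -> derivable gamma s 1 /\ derivable (derive1 gamma) s 1.

(* The hypersurface x, defined on D, is after a rotation of E^2 and a change of
   the arclength parameter the restriction of the hypersurface y, defined on D',
   to a part of D'.  That part is open whenever D is, the change of parameter
   being a homeomorphism for e = 1 or -1. *)
Definition open_part_up_to_rotation (R : realType) (n : nat)
    (D : set 'rV[R]_(1 + n.-1)) (x : 'rV[R]_(1 + n.-1) -> 'rV[R]_(2 + n.-1))
    (D' : set 'rV[R]_(1 + n.-1)) (y : 'rV[R]_(1 + n.-1) -> 'rV[R]_(2 + n.-1)) :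
    Prop :=
  exists A : 'M[R]_2, exists e b : R,
    [/\ is_rotation A, e = 1 \/ e = -1
      & forall u, D u -> D' (change_arclength e b u) /\
          rotate_plane A (x u) = y (change_arclength e b u)].

(* Main.v *)
(* With T = gamma' and f = <gamma, T>, the canonical field of the hypercylinder
   is (f, t_2, ..., t_n) in an orthonormal coordinate frame, so it is
   incompressible exactly when f' = 1 - n.

   Then f = (1 - n) (s + b0), and h = <gamma, J T> (J the quarter turn)
   satisfies h' = - k f and k h = - n, where k is the curvature; hence h never
   vanishes and h^2 = n (n - 1) (c^2 - (s + b0)^2) for some c > 0.  Reversing s
   to make h negative gives k = K', so that T e^{-iK} is constant, and
   gamma = f T + h J T is the model curve up to a rotation.

   Conversely |gamma|^2 = n (n - 1) c^2 - (n - 1) (e s + b)^2 is invariant under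
   rotations, and half of its second derivative is f' = 1 - n. *)
Require Import Defs.
From HB Require Import structures.
From mathcomp Require Import all_boot all_order all_algebra.
From mathcomp Require Import all_classical all_reals all_analysis.
From mathcomp Require Import ring lra.
Import Order.TTheory GRing.Theory Num.Theory.
Import numFieldNormedType.Exports.
Local Open Scope classical_set_scope.
Local Open Scope ring_scope.

(** * Euclidean inner product of row vectors *)

Section DotProduct.
Context {R : realType}.

Lemma dot_row_mx {m k : nat} (a c : 'rV[R]_m) (b d : 'rV[R]_k) :
  dot (row_mx a b) (row_mx c d) = dot a c + dot b d.
Proof.
rewrite /dot big_split_ord; congr (_ + _); apply: eq_bigr => i _.
  by rewrite !row_mxEl.
by rewrite !row_mxEr.
Qed.

Lemma dot_scale {m : nat} (a b : R) (u v : 'rV[R]_m) :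
  dot (a *: u) (b *: v) = a * b * dot u v.
Proof.
rewrite /dot mulr_sumr; apply: eq_bigr => i _.
by rewrite !mxE; ring.
Qed.

Lemma dot_delta {m : nat} (u : 'rV[R]_m) (j : 'I_m) :
  dot u (delta_mx 0 j) = u 0 j.
Proof.
rewrite /dot (bigD1 j) //= big1 ?addr0 ?mxE ?eqxx ?mulr1// => i /negPf ij.
by rewrite mxE ij mulr0.
Qed.

Lemma dot2E (u v : 'rV[R]_2) : dot u v = u 0 0 * v 0 0 + u 0 1 * v 0 1.
Proof.
rewrite /dot big_ord_recl big_ord1.
by rewrite (_ : lift ord0 ord0 = 1 :> 'I_2)//; apply/val_inj.
Qed.

End DotProduct.

(** * Directional derivatives, entry by entry *)

Section Coordinates.
Context {R : realType}.

(** The two difference quotients are the same function of the increment, so this is not an instance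
    of the chain rule. *)
Lemma is_derive_comp_coord {m k : nat} {W : normedModType R} (f : R -> W)
    (i : 'I_m) (j : 'I_k) (u v : 'M[R]_(m, k)) (d : W) :
  is_derive (u i j) (v i j) f d -> is_derive u v (fun w => f (w i j)) d.
Proof.
have E : (fun h : R => h^-1 *:
      (((fun w : 'M[R]_(m, k) => f (w i j)) \o shift u) (h *: v) - f (u i j)))
    = (fun h : R => h^-1 *:
      ((f \o shift (u i j)) (h *: (v i j)) - f (u i j))).
  by apply/funext => h /=; rewrite !mxE.
by case=> df <-; apply: DeriveDef; rewrite ?/derivable ?/derive E.
Qed.

Lemma is_derive_coord {m k : nat} (i : 'I_m) (j : 'I_k) (u v : 'M[R]_(m, k)) :
  is_derive u v (fun w => w i j) (v i j).
Proof. exact: (@is_derive_comp_coord _ _ _ id). Qed.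

Lemma is_derive_mxP {V : normedModType R} {m k : nat} (M : V -> 'M[R]_(m, k))
    (t v : V) (d : 'M[R]_(m, k)) :
  is_derive t v M d <->
  forall i j, is_derive t v (fun x => M x i j) (d i j).
Proof.
split=> [[dM <-] i j|H].
  split; first by move/derivable_mxP: dM; exact.
  by rewrite derive_mx// mxE.
have dM : derivable M t v by apply/derivable_mxP => i j; case: (H i j).
split=> //; rewrite derive_mx//; apply/matrixP => i j; rewrite mxE.
by case: (H i j).
Qed.

Lemma is_derive_scale_dir {V W : normedModType R} (f : V -> W) (t v : V) (a : R)
    (d : W) :
  differentiable f t -> is_derive t v f d -> is_derive t (a *: v) f (a *: d).
Proof.
move=> df [_ <-]; split; first exact: diff_derivable.
by rewrite !deriveE// linearZ.
Qed.

Lemma derivable_is_derive1 {W : normedModType R} (f : R -> W) (s : R) :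
  derivable f s 1 -> is_derive s 1 f (derive1 f s).
Proof. by move=> df; split=> //; rewrite derive1E. Qed.

End Coordinates.

(** * Metric, canonical field and divergence of a hypercylinder *)

Section Divergence.
Context {R : realType} {n : nat}.
Variables (I : set R) (gamma : R -> 'rV[R]_2).
Hypothesis Iopen : open I.
Hypothesis gamma_diff : twice_derivable I gamma.
Hypothesis gamma_unit : unit_speed I gamma.

Let x := @hypercylinder R n gamma.

Lemma is_derive_hypercylinder (u v : 'rV[R]_(1 + n.-1)) : I (arclength u) ->
  is_derive u v x
    (row_mx (arclength v *: derive1 gamma (arclength u)) (rsubmx v)).
Proof.
move=> Iu; apply/is_derive_mxP => i j; rewrite ord1 {i}.
case: (split_ordP j) => k ->.
  rewrite row_mxEl.
  under [X in is_derive _ _ X _]eq_fun do rewrite /x /hypercylinder row_mxEl.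
  apply: (@is_derive_comp_coord _ _ _ _ (fun s => gamma s 0 k)).
  (* The curve is now differentiated along [v 0 0]; as a multiple of 1 this direction reduces to
     [derive1]. *)
  have -> : v 0 0 = v 0 0 *: (1 : R) by rewrite /GRing.scale/= mulr1.
  rewrite mxE; have [dg _] := gamma_diff _ Iu.
  have dgk := (is_derive_mxP _ _ _ _).1 (derivable_is_derive1 _ _ dg) 0 k.
  apply: is_derive_scale_dir => //.
  by apply/derivable1_diffP; case: dgk.
rewrite row_mxEr.
under [X in is_derive _ _ X _]eq_fun do
  rewrite /x /hypercylinder row_mxEr mxE.
by rewrite mxE; exact: is_derive_coord.
Qed.

Lemma partial_hypercylinder (u : 'rV[R]_(1 + n.-1)) i : I (arclength u) ->
  partial x i u = row_mx
    (arclength (delta_mx 0 i) *: derive1 gamma (arclength u))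
    (rsubmx (delta_mx 0 i)).
Proof.
by move=> Iu; have [_] := is_derive_hypercylinder u (delta_mx 0 i) Iu.
Qed.

Lemma row_arclength (v : 'rV[R]_(1 + n.-1)) :
  v = row_mx (arclength v)%:M (rsubmx v).
Proof.
rewrite -[LHS]hsubmxK; congr row_mx; apply/rowP => i.
by rewrite !mxE !ord1 eqxx mulr1n /arclength; congr (v 0 _); apply/val_inj.
Qed.

Lemma dot1 (a b : R) : dot (a%:M : 'rV[R]_1) b%:M = a * b.
Proof. by rewrite /dot big_ord1 !mxE eqxx !mulr1n. Qed.

Lemma induced_metric_hypercylinder (u : 'rV[R]_(1 + n.-1)) :
  I (arclength u) -> induced_metric x u = 1%:M.
Proof.
move=> Iu; apply/matrixP => i j; rewrite !mxE.
rewrite !partial_hypercylinder// dot_row_mx dot_scale.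
(* Unit speed eliminates the curve; what remains is the product of two basis vectors in block form,
   which [row_arclength] reassembles. *)
rewrite (gamma_unit _ Iu) mulr1 -dot1 -dot_row_mx -!row_arclength dot_delta mxE.
by rewrite eqxx eq_sym.
Qed.

Lemma canonical_field_hypercylinder (u : 'rV[R]_(1 + n.-1)) :
  I (arclength u) ->
  canonical_field x u =
  row_mx (dot (gamma (arclength u)) (derive1 gamma (arclength u)))%:M
    (rsubmx u).
Proof.
move=> Iu; rewrite /canonical_field /tangential_component.
rewrite induced_metric_hypercylinder// invmx1 mulmx1.
apply/rowP => j; rewrite mxE partial_hypercylinder// dot_row_mx.
rewrite -[X in dot X _]scale1r dot_scale mul1r mulrC -dot1 -dot_row_mx.
by rewrite -row_arclength dot_delta.
Qed.

Lemma near_cylinder_domain (u : 'rV[R]_(1 + n.-1)) : I (arclength u) ->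
  \forall v \near u, I (arclength v).
Proof.
move=> Iu; have /= := @coord_continuous R 1 (1 + n.-1) 0 0 u.
by apply; exact: open_nbhs_nbhs.
Qed.

(** The metric is known to be the identity only over [I]; since [I] is open it is constant near [u],
    which suffices for its derivatives to vanish. *)
Lemma christoffel_hypercylinder (u : 'rV[R]_(1 + n.-1)) i j k :
  I (arclength u) -> christoffel (induced_metric x) k i j u = 0.
Proof.
move=> Iu; rewrite /christoffel.
have g0 a b l : partial (fun v => induced_metric x v a b) l u = 0.
  rewrite /partial.
  rewrite -(derive_cst ((1%:M : 'M[R]_(1 + n.-1)) a b) u (delta_mx 0 l)).
  apply: near_eq_derive; near=> v; rewrite induced_metric_hypercylinder//.
  by near: v; exact: near_cylinder_domain.
by rewrite big1 ?mulr0// => l _; rewrite !g0 addr0 subr0 mulr0.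
Unshelve. all: by end_near. Qed.

(** The coordinates are flat, so the divergence is the sum of the plain partial derivatives: [d]
    from the arclength direction and 1 from each of the [n.-1] fields t_j. *)
Lemma divergence_hypercylinder (u : 'rV[R]_(1 + n.-1)) (d : R) :
  I (arclength u) ->
  is_derive (arclength u) 1 (fun s => dot (gamma s) (derive1 gamma s)) d ->
  divergence (induced_metric x) (canonical_field x) u = d + n.-1%:R.
Proof.
move=> Iu dd; rewrite /divergence.
have -> : \sum_i covariant_deriv (induced_metric x) (canonical_field x) i i u
    = \sum_(i < 1 + n.-1) partial (fun v => canonical_field x v 0 i) i u.
  apply: eq_bigr => i _; rewrite /covariant_deriv big1 ?addr0// => j _.
  by rewrite christoffel_hypercylinder// mul0r.
have cE (i : 'I_(1 + n.-1)) (e : R) :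
    is_derive u (delta_mx 0 i) (fun v : 'rV[R]_(1 + n.-1) =>
       (row_mx (dot (gamma (arclength v)) (derive1 gamma (arclength v)))%:M
          (rsubmx v) : 'rV[R]_(1 + n.-1)) 0 i) e ->
    partial (fun v => canonical_field x v 0 i) i u = e.
  move=> [_ <-]; apply: near_eq_derive; near=> v.
  rewrite canonical_field_hypercylinder//.
  by near: v; exact: near_cylinder_domain.
rewrite big_split_ord big_ord1; congr (_ + _).
  apply: cE; under [X in is_derive _ _ X _]eq_fun do
    rewrite row_mxEl mxE eqxx mulr1n.
  apply: (@is_derive_comp_coord _ _ _ _
    (fun s => dot (gamma s) (derive1 gamma s))).
  by rewrite mxE.
transitivity (\sum_(i < n.-1) (1 : R)); last by rewrite sumr_const card_ord.
apply: eq_bigr => j _; apply: cE.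
under [X in is_derive _ _ X _]eq_fun do rewrite row_mxEr mxE.
by apply: is_derive_eq (is_derive_coord _ _ _ _) _; rewrite mxE !eqxx.
Unshelve. all: by end_near. Qed.

End Divergence.

(** * Calculus on open sets and intervals, and the derivative of K *)

Section RealFunctions.
Context {R : realType}.

(** Allows an identity that holds only on [I] to be differentiated there. *)
Lemma eq_on_open_is_derive {W : normedModType R} (I : set R) (f g : R -> W)
    (s : R) (d : W) :
  open I -> I s -> (forall t, I t -> f t = g t) ->
  is_derive s 1 f d -> is_derive s 1 g d.
Proof.
move=> oI Is fg; apply: near_eq_is_derive; near=> t; apply: fg; near: t.
exact: open_nbhs_nbhs.
Unshelve. all: by end_near. Qed.

Lemma derive_within_continuous (I : set R) (f df : R -> R) (a b : R) :
  is_interval I -> I a -> I b -> (forall t, I t -> is_derive t 1 f (df t)) ->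
  {within `[a, b], continuous f}.
Proof.
move=> iI Ia Ib Df; apply: derivable_within_continuous => t.
by rewrite in_itv/= => tab; case: (Df t (iI _ _ Ia Ib _ tab)).
Qed.

(** Mean value theorem on the segment joining the two points, which stays in the interval. *)
Lemma is_derive0_cst_on_interval (I : set R) (f : R -> R) :
  is_interval I -> (forall t, I t -> is_derive t 1 f 0) ->
  forall a b, I a -> I b -> f a = f b.
Proof.
move=> iI Df a b; wlog ab : a b / a <= b => [H|Ia Ib].
  by case: (leP a b) => [|/ltW] ab Ia Ib; [|apply/esym]; exact: H.
have [t||c _] := @MVT_segment R f (fun=> 0) a b ab.
- rewrite in_itv/= => /andP[/ltW a_t /ltW tb]; apply: Df.
  by apply: (iI _ _ Ia Ib); rewrite a_t tb.
- exact: derive_within_continuous Df.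
- by rewrite mul0r => /eqP; rewrite subr_eq0 => /eqP.
Qed.

(** Intermediate value theorem: opposite signs would force a zero in between. The product expresses
    equality of signs without a case distinction. *)
Lemma nonvanishing_same_sign (I : set R) (f df : R -> R) :
  is_interval I -> (forall t, I t -> is_derive t 1 f (df t)) ->
  (forall t, I t -> f t != 0) ->
  forall a b, I a -> I b -> 0 < f a * f b.
Proof.
move=> iI Df f0 a b; wlog ab : a b / a <= b => [H|Ia Ib].
  by case: (leP a b) => [|/ltW] ab Ia Ib; [|rewrite mulrC]; exact: H.
rewrite lt_neqAle eq_sym mulf_neq0 ?f0//= leNgt; apply/negP => fab.
have [|c] := IVT (v := 0) ab (derive_within_continuous _ _ _ _ _ iI Ia Ib Df).
- rewrite ge_min le_max; move: fab.
  by case: (ltgtP (f a) 0) => [fa|fa|->]; rewrite ?mul0r ?ltxx// =>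
    + ; [rewrite nmulr_rlt0//|rewrite pmulr_rlt0//] => /ltW ->; rewrite ?orbT.
- rewrite in_itv/= => cab fc.
  by have := f0 c (iI _ _ Ia Ib _ cab); rewrite fc eqxx.
Qed.

(** The arctangent in K equals arcsin (s / c), which explains the single square root in the
    derivative. *)
Lemma is_derive_Kfun (n : nat) (c s : R) : - c < s < c ->
  is_derive s 1 (Kfun n c)
    (Num.sqrt n%:R / Num.sqrt (n%:R - 1) / Num.sqrt (c ^+ 2 - s ^+ 2)).
Proof.
move=> /andP[cs sc].
have w0 : 0 < c ^+ 2 - s ^+ 2 by nra.
have r0 : 0 < Num.sqrt (c ^+ 2 - s ^+ 2) by rewrite sqrtr_gt0.
have rn0 := lt0r_neq0 r0.
have Dw : is_derive s 1 (fun t => c ^+ 2 - t ^+ 2) (- (2 * s)).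
  have D := is_deriveB (is_derive_cst (c ^+ 2) s 1)
    (is_deriveX 2 (is_derive_id s 1)).
  by apply: is_derive_eq D _; rewrite /GRing.scale/=; ring.
have Dr : is_derive s 1 (fun t => Num.sqrt (c ^+ 2 - t ^+ 2))
    ((2 * Num.sqrt (c ^+ 2 - s ^+ 2))^-1 * - (2 * s)).
  exact: (@is_derive1_comp _ Num.sqrt (fun t => c ^+ 2 - t ^+ 2)
    s _ _ (is_derive1_sqrt w0) Dw).
have Dv := @is_deriveV _ (fun t => Num.sqrt (c ^+ 2 - t ^+ 2)) _ _ _ rn0 Dr.
have Dq := is_deriveM (is_derive_id s 1) Dv.
have Da := @is_derive1_comp _ atan (fun t => t / Num.sqrt (c ^+ 2 - t ^+ 2))
  s _ _ (is_derive1_atan _) Dq.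
have Dk := is_deriveZ (Num.sqrt n%:R / Num.sqrt (n%:R - 1)) Da.
apply: is_derive_eq Dk _.
set k := _ / Num.sqrt (n%:R - 1).
have r2 := sqr_sqrtr (ltW w0).
move: r2 rn0; set r := Num.sqrt _ => r2 rn0; rewrite /GRing.scale/=.
(* With r the root, c^2 = r^2 + s^2 is the numerator of 1 + (s / r)^2, the denominator produced by
   the arctangent; it must be nonzero for [field]. *)
have c2 : c ^+ 2 = r ^+ 2 + s ^+ 2 by rewrite r2; ring.
have c0 : r ^+ 2 + s ^+ 2 != 0 by rewrite -c2; apply/lt0r_neq0; nra.
field.
by rewrite rn0 c0.
Qed.

End RealFunctions.

(** * Integration of the curve equations, and the norm of the model curve *)

Section PlaneCurve.
Context {R : realType}.

Lemma model_curve_fst (n : nat) (c t : R) :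
  model_curve n c t 0 0 = (1 - n%:R) * t * cos (Kfun n c t)
    + Num.sqrt (n%:R * (n%:R - 1)) * Num.sqrt (c ^+ 2 - t ^+ 2)
      * sin (Kfun n c t).
Proof.
rewrite (_ : (0 : 'I_2) = lshift 1 (0 : 'I_1)); last exact/val_inj.
by rewrite [LHS]row_mxEl mxE eqxx mulr1n.
Qed.

Lemma model_curve_snd (n : nat) (c t : R) :
  model_curve n c t 0 1 = (1 - n%:R) * t * sin (Kfun n c t)
    - Num.sqrt (n%:R * (n%:R - 1)) * Num.sqrt (c ^+ 2 - t ^+ 2)
      * cos (Kfun n c t).
Proof.
rewrite (_ : (1 : 'I_2) = rshift 1 (0 : 'I_1)); last exact/val_inj.
by rewrite [LHS]row_mxEr mxE eqxx mulr1n.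
Qed.

(* The isometry of the plane carrying the model to the curve is multiplication
   by the unit complex number w1 + i w2. *)
Lemma curve_of_incompressible (n : nat) (I : set R) (p q p1 q1 p2 q2 : R -> R) :
  (1 < n)%N -> open I -> is_interval I -> I !=set0 ->
  (forall s, I s -> is_derive s 1 p (p1 s)) ->
  (forall s, I s -> is_derive s 1 q (q1 s)) ->
  (forall s, I s -> is_derive s 1 p1 (p2 s)) ->
  (forall s, I s -> is_derive s 1 q1 (q2 s)) ->
  (forall s, I s -> p1 s ^+ 2 + q1 s ^+ 2 = 1) ->
  (forall s, I s -> p s * p2 s + q s * q2 s = - n%:R) ->
  exists2 c : R, 0 < c & exists e b w1 w2 : R,
    [/\ e = 1 \/ e = - 1, w1 ^+ 2 + w2 ^+ 2 = 1
      & forall s, I s -> let t := e * s + b in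
        [/\ - c < t < c,
            p s * w1 + q s * w2 = model_curve n c t 0 0
          & q s * w1 - p s * w2 = model_curve n c t 0 1]].
Proof.
move=> n1 oI iI [s0 Is0] Dp Dq Dp1 Dq1 unit inc.
have N1 : 1 < n%:R :> R by rewrite ltr1n.
pose N : R := n%:R; rewrite -/N in N1 inc.
(* [f] and [h] are the coordinates of the curve in the orthonormal frame T = (p1, q1), J T = (-q1,
   p1), and [k] is the curvature. *)
pose f s := p s * p1 s + q s * q1 s.
pose h s := q s * p1 s - p s * q1 s.
pose k s := p1 s * q2 s - q1 s * p2 s.
have pE s : I s -> p s = f s * p1 s - h s * q1 s.
  by move=> Is; rewrite -[LHS]mulr1 -(unit s Is) /f /h; ring.
have qE s : I s -> q s = f s * q1 s + h s * p1 s.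
  by move=> Is; rewrite -[LHS]mulr1 -(unit s Is) /f /h; ring.
(* Differentiating |T|^2 = 1 shows that T' is orthogonal to T; hence the Frenet equation T' = k J T
   in [p2E] and [q2E]. *)
have orth s : I s -> p1 s * p2 s + q1 s * q2 s = 0.
  move=> Is.
  have D1 := is_deriveD (is_deriveX 2 (Dp1 s Is)) (is_deriveX 2 (Dq1 s Is)).
  have [_ /=] : is_derive s 1 (cst (1 : R))
      ((2 * p1 s ^+ 1) *: p2 s + (2 * q1 s ^+ 1) *: q2 s).
    exact: eq_on_open_is_derive oI Is unit D1.
  rewrite derive_cst /GRing.scale/= => E.
  by apply: (@mulfI _ 2) => //; rewrite mulr0 E; ring.
have p2E s : I s -> p2 s = - k s * q1 s.
  move=> Is; have u := unit s Is; have o := orth s Is.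
  rewrite -[LHS]mulr1 -u /k.
  have -> : p2 s * (p1 s ^+ 2 + q1 s ^+ 2) = p1 s * (p1 s * p2 s + q1 s * q2 s)
    - (p1 s * q2 s - q1 s * p2 s) * q1 s by ring.
  by rewrite o; ring.
have q2E s : I s -> q2 s = k s * p1 s.
  move=> Is; have u := unit s Is; have o := orth s Is.
  rewrite -[LHS]mulr1 -u /k.
  have -> : q2 s * (p1 s ^+ 2 + q1 s ^+ 2) = q1 s * (p1 s * p2 s + q1 s * q2 s)
    + (p1 s * q2 s - q1 s * p2 s) * p1 s by ring.
  by rewrite o; ring.
have khE s : I s -> k s * h s = - N.
  by move=> Is; rewrite -(inc s Is) (p2E s Is) (q2E s Is) /h; ring.
have Df s : I s -> is_derive s 1 f (1 - N).
  move=> Is; have u := unit s Is; have i := inc s Is.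
  have D := is_deriveD (is_deriveM (Dp s Is) (Dp1 s Is))
    (is_deriveM (Dq s Is) (Dq1 s Is)).
  by apply: is_derive_eq D _; rewrite -u -i /GRing.scale/=; ring.
have Dh s : I s -> is_derive s 1 h (- k s * f s).
  move=> Is.
  have D := is_deriveB (is_deriveM (Dq s Is) (Dp1 s Is))
    (is_deriveM (Dp s Is) (Dq1 s Is)).
  apply: is_derive_eq D _.
  by rewrite /GRing.scale/= (p2E s Is) (q2E s Is) /f; ring.
(* Integration constant making f = (1 - N) (s + b0) true at [s0]. *)
pose b0 := f s0 / (1 - N) - s0.
have N10 : 1 - N != 0 by rewrite subr_eq0 lt_eqF.
have fE s : I s -> f s = (1 - N) * (s + b0).
  move=> Is.
  have Dg t : I t -> is_derive t 1 (f - (1 - N) *: id) 0.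
    move=> It; have D := is_deriveB (Df t It)
      (is_deriveZ (1 - N) (is_derive_id t 1)).
    by apply: is_derive_eq D _; rewrite /GRing.scale/=; ring.
  have := is_derive0_cst_on_interval I _ iI Dg s s0 Is Is0.
  rewrite !fctE/= /GRing.scale/= => /eqP; rewrite subr_eq => /eqP ->.
  by rewrite /b0; field.
(* Value at [s0] of a first integral: 2 h h' = - 2 k h f = 2 N f cancels the derivative of the other
   term. *)
pose D := h s0 ^+ 2 + N * (N - 1) * (s0 + b0) ^+ 2.
have hE s : I s -> h s ^+ 2 = D - N * (N - 1) * (s + b0) ^+ 2.
  move=> Is.
  have Dg t : I t -> is_derive t 1
      (h ^+ 2 + (N * (N - 1)) *: (id + cst b0) ^+ 2) 0.
    move=> It.
    have D1 := is_deriveX 2 (is_deriveD (is_derive_id t 1)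
      (is_derive_cst b0 t 1)).
    have D2 := is_deriveD (is_deriveX 2 (Dh t It))
      (is_deriveZ (N * (N - 1)) D1).
    apply: is_derive_eq D2 _; rewrite /GRing.scale/= (fE t It).
    have -> : (2 * h t ^+ 1) * (- k t * ((1 - N) * (t + b0))) =
      2 * (N - 1) * (t + b0) * (k t * h t) by ring.
    by rewrite (khE t It) !fctE/=; ring.
  have := is_derive0_cst_on_interval I _ iI Dg s s0 Is Is0.
  by rewrite !fctE/= /GRing.scale/= -/D => <-; ring.
have h0 s : I s -> h s != 0.
  move=> Is; apply/eqP => hs; have := khE s Is.
  by rewrite hs mulr0; nra.
have hh s : I s -> 0 < h s * h s0.
  by move=> Is; exact: (nonvanishing_same_sign I h _ iI Dh h0).
have a0 : 0 < N * (N - 1) by nra.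
have D0 : 0 < D.
  have := hh s0 Is0; rewrite -expr2 /D.
  by move=> h20; rewrite ltr_pwDl// mulr_ge0 ?sqr_ge0// ltW.
(* Chosen so that D = N (N - 1) c^2; positive because [h] does not vanish at [s0]. *)
pose c := Num.sqrt (D / (N * (N - 1))).
have c2 : c ^+ 2 = D / (N * (N - 1)) by rewrite sqr_sqrtr// divr_ge0// ltW.
have c0 : 0 < c by rewrite sqrtr_gt0 divr_gt0.
exists c => //.
(* [h] has constant sign, and this choice makes [- e * h] positive, hence equal to the product of
   square roots in the model ([rE]). *)
pose e : R := if h s0 < 0 then 1 else -1.
have e1 : e = 1 \/ e = - 1 by rewrite /e; case: ifP; [left|right].
have e2 : e * e = 1 by case: e1 => ->; ring.
have eh s : I s -> 0 < - e * h s.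
  move=> Is; have := hh s Is; rewrite /e.
  have /orP[H|H] : (h s0 < 0) || (0 < h s0) by rewrite -neq_lt h0.
    by rewrite H (nmulr_lgt0 _ H) => hs; rewrite mulN1r oppr_gt0.
  by rewrite [h s0 < 0]ltNge (ltW H)/= pmulr_lgt0// opprK mul1r.
pose t s := e * s + e * b0.
have tE s : t s ^+ 2 = (s + b0) ^+ 2.
  by rewrite /t -mulrDr exprMn expr2 e2 mul1r.
have wE s : I s -> N * (N - 1) * (c ^+ 2 - t s ^+ 2) = h s ^+ 2.
  move=> Is; rewrite c2 tE hE//; have := lt0r_neq0 a0.
  by rewrite mulf_eq0 negb_or => /andP[A B]; field; rewrite A B.
have w0 s : I s -> 0 < c ^+ 2 - t s ^+ 2.
  move=> Is; rewrite -(pmulr_rgt0 _ a0) wE//.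
  by rewrite exprn_even_gt0//= h0.
have tc s : I s -> - c < t s < c.
  move=> Is; rewrite -ltr_norml -[ltRHS]gtr0_norm// -ltr_sqr ?nnegrE//.
  by rewrite !real_normK ?num_real// -subr_gt0 w0.
have rE s : I s ->
    Num.sqrt (N * (N - 1)) * Num.sqrt (c ^+ 2 - t s ^+ 2) = - e * h s.
  move=> Is; rewrite -sqrtrM ?(ltW a0)// wE//.
  have -> : h s ^+ 2 = (- e * h s) ^+ 2 by rewrite -[LHS]mul1r -e2; ring.
  by rewrite sqrtr_sqr gtr0_norm// eh.
pose K s := Kfun n c (t s).
have DK s : I s -> is_derive s 1 K (k s).
  move=> Is.
  have Dt : is_derive s 1 t e.
    have D1 := is_deriveD (is_deriveZ e (is_derive_id s 1))
      (is_derive_cst (e * b0) s 1).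
    by apply: is_derive_eq D1 _; rewrite /GRing.scale/=; ring.
  have D1 := @is_derive1_comp _ (Kfun n c) t s _ _
    (is_derive_Kfun n c (t s) (tc s Is)) Dt.
  apply: is_derive_eq D1 _; rewrite -/N.
  (* After multiplication by the nonzero [h], both sides equal - N: k h by [khE], and the derivative
     of K because [rE] expresses [h] through the same roots. *)
  apply: (mulIf (h0 s Is)); rewrite khE//.
  have -> : h s = - e * (Num.sqrt (N * (N - 1)) * Num.sqrt (c ^+ 2 - t s ^+ 2)).
    by rewrite rE// -[LHS]mul1r -e2; ring.
  have NN : N - 1 > 0 by rewrite subr_gt0.
  rewrite sqrtrM; last by nra.
  have sN : Num.sqrt N * Num.sqrt N = N by rewrite -expr2 sqr_sqrtr//; nra.
  have s1 : Num.sqrt (N - 1) != 0 by rewrite gt_eqF// sqrtr_gt0.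
  have s2 : Num.sqrt (c ^+ 2 - t s ^+ 2) != 0 by rewrite gt_eqF// sqrtr_gt0 w0.
  transitivity (- (e * e * (Num.sqrt N * Num.sqrt N))).
    by field; rewrite s1 s2.
  by rewrite e2 sN mul1r.
have Dcos s : I s -> is_derive s 1 (cos \o K) (- sin (K s) * k s).
  by move=> Is; exact: is_derive1_comp (is_derive_cos _) (DK s Is).
have Dsin s : I s -> is_derive s 1 (sin \o K) (cos (K s) * k s).
  by move=> Is; exact: is_derive1_comp (is_derive_sin _) (DK s Is).
(* P + i Q is T e^{-iK} in complex notation. *)
pose P s := p1 s * cos (K s) + q1 s * sin (K s).
pose Q s := q1 s * cos (K s) - p1 s * sin (K s).
have DP s : I s -> is_derive s 1 P 0.
  move=> Is; have D1 := is_deriveD (is_deriveM (Dp1 s Is) (Dcos s Is))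
    (is_deriveM (Dq1 s Is) (Dsin s Is)).
  apply: is_derive_eq D1 _; rewrite /GRing.scale/= (p2E s Is) (q2E s Is).
  by ring.
have DQ s : I s -> is_derive s 1 Q 0.
  move=> Is; have D1 := is_deriveB (is_deriveM (Dq1 s Is) (Dcos s Is))
    (is_deriveM (Dp1 s Is) (Dsin s Is)).
  apply: is_derive_eq D1 _; rewrite /GRing.scale/= (p2E s Is) (q2E s Is).
  by ring.
have PE s : I s -> P s = P s0.
  by move=> Is; exact: (is_derive0_cst_on_interval I P iI DP).
have QE s : I s -> Q s = Q s0.
  by move=> Is; exact: (is_derive0_cst_on_interval I Q iI DQ).
(* With w = e (P + i Q), the curve (f + i h) T times the conjugate of w is e (f + i h) e^{iK}. This
   is the model, as e f = (1 - N) t and - e h is the product of roots. *)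
exists e, (e * b0), (e * P s0), (e * Q s0); split=> //.
  have u := unit s0 Is0; have cs := cos2Dsin2 (K s0).
  transitivity (e * e * ((p1 s0 ^+ 2 + q1 s0 ^+ 2)
    * (cos (K s0) ^+ 2 + sin (K s0) ^+ 2))); first by rewrite /P /Q; ring.
  by rewrite e2 u cs; ring.
move=> s Is t'; have {t'}-> : t' = t s by [].
split; first exact: tc.
- rewrite model_curve_fst -/N rE// -/(K s) -(PE s Is) -(QE s Is).
  rewrite (pE s Is) (qE s Is) (fE s Is).
  have u := unit s Is.
  transitivity (e * (p1 s ^+ 2 + q1 s ^+ 2)
    * ((1 - N) * (s + b0) * cos (K s) - h s * sin (K s))).
    by rewrite /P /Q; ring.
  by rewrite u /t; ring.
- rewrite model_curve_snd -/N rE// -/(K s) -(PE s Is) -(QE s Is).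
  rewrite (pE s Is) (qE s Is) (fE s Is).
  have u := unit s Is.
  transitivity (e * (p1 s ^+ 2 + q1 s ^+ 2)
    * ((1 - N) * (s + b0) * sin (K s) + h s * cos (K s))).
    by rewrite /P /Q; ring.
  by rewrite u /t; ring.
Qed.

(** The model curve is the complex number (1 - n) t - i r turned by e^{iK}, with r the product of
    roots, so K drops out of its norm. *)
Lemma dot_model_curve (n : nat) (c t : R) : (0 < n)%N -> - c < t < c ->
  dot (model_curve n c t) (model_curve n c t) =
  n%:R * (n%:R - 1) * c ^+ 2 - (n%:R - 1) * t ^+ 2.
Proof.
move=> n0 /andP[ct tc]; rewrite dot2E model_curve_fst model_curve_snd.
set N : R := n%:R; set C := cos _; set S := sin _.
set a := Num.sqrt (N * (N - 1)); set r := Num.sqrt _.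
have CS : C ^+ 2 + S ^+ 2 = 1 by exact: cos2Dsin2.
have a2 : a ^+ 2 = N * (N - 1).
  by rewrite sqr_sqrtr// mulr_ge0// ?subr_ge0 ?ler1n ?ler0n.
have r2 : r ^+ 2 = c ^+ 2 - t ^+ 2 by rewrite sqr_sqrtr//; nra.
transitivity (((N - 1) ^+ 2 * t ^+ 2 + a ^+ 2 * r ^+ 2) * (C ^+ 2 + S ^+ 2)).
  by ring.
by rewrite CS a2 r2; ring.
Qed.

End PlaneCurve.

(** * Passage between the hypersurface and its planar curve *)

Section Hypercylinder.
Context {R : realType} {n : nat}.

Lemma is_derive_dot {m : nat} (f g : R -> 'rV[R]_m) (s : R) (df dg : 'rV[R]_m) :
  is_derive s 1 f df -> is_derive s 1 g dg ->
  is_derive s 1 (fun t => dot (f t) (g t)) (dot (f s) dg + dot df (g s)).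
Proof.
move=> /is_derive_mxP Df /is_derive_mxP Dg.
have D := is_derive_sum (fun i => is_deriveM (Df 0 i) (Dg 0 i)).
have E : (fun t => dot (f t) (g t)) =
    \sum_(i < m) ((fun t => f t 0 i) * (fun t => g t 0 i)).
  by apply/funext => t; rewrite fct_sumE.
rewrite E; apply: is_derive_eq D _; rewrite big_split /=; congr (_ + _).
by apply: eq_bigr => i _; rewrite /GRing.scale/= mulrC.
Qed.

Lemma dot_mulmx {m : nat} (A : 'M[R]_m) (u v : 'rV[R]_m) :
  A *m A^T = 1%:M -> dot (u *m A) (v *m A) = dot u v.
Proof.
have dotE (a b : 'rV[R]_m) : dot a b = (a *m b^T) 0 0.
  by rewrite mxE; apply: eq_bigr => i _; rewrite mxE.
by move=> AA; rewrite !dotE trmx_mul mulmxA -(mulmxA u) AA mulmx1.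
Qed.

Lemma arclength_row_mx (s : R) (w : 'rV[R]_n.-1) :
  arclength (row_mx s%:M w : 'rV[R]_(1 + n.-1)) = s.
Proof.
rewrite /arclength (_ : 0 = lshift n.-1 (0 : 'I_1)); last exact/val_inj.
by rewrite row_mxEl mxE eqxx mulr1n.
Qed.

Lemma hypercylinder_change_arclength (gamma : R -> 'rV[R]_2) (e b : R)
    (u : 'rV[R]_(1 + n.-1)) :
  hypercylinder gamma (change_arclength e b u) =
  row_mx (gamma (e * arclength u + b)) (rsubmx u).
Proof. by rewrite /hypercylinder arclength_row_mx row_mxKr. Qed.

Lemma rotate_hypercylinder (gamma : R -> 'rV[R]_2) (A : 'M[R]_2)
    (u : 'rV[R]_(1 + n.-1)) :
  rotate_plane A (hypercylinder gamma u) =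
  row_mx (gamma (arclength u) *m A) (rsubmx u).
Proof. by rewrite /rotate_plane row_mxKl row_mxKr. Qed.

(** Rotations and changes of arclength leave t_2, ..., t_n alone, so only the planar blocks matter;
    evaluating at t = 0 recovers the condition on the curves. *)
Lemma open_part_hypercylinder (I J : set R) (gamma delta : R -> 'rV[R]_2) :
  open_part_up_to_rotation (cylinder_domain I) (@hypercylinder R n gamma)
    (cylinder_domain J) (hypercylinder delta) <->
  exists A e b, [/\ is_rotation A, e = 1 \/ e = -1
    & forall s, I s -> J (e * s + b) /\ gamma s *m A = delta (e * s + b)].
Proof.
split=> -[A [e [b [rA e1 H]]]]; exists A, e, b; split=> //.
  move=> s Is; have [] := H (row_mx s%:M 0).
    by rewrite /cylinder_domain/= arclength_row_mx.
  rewrite rotate_hypercylinder hypercylinder_change_arclength.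
  by rewrite /cylinder_domain/= !arclength_row_mx => Js /eq_row_mx[].
move=> u Iu; rewrite rotate_hypercylinder hypercylinder_change_arclength.
by rewrite /cylinder_domain/= arclength_row_mx; have [Js ->] := H _ Iu.
Qed.

(** The divergence is f' + (n - 1), where f' exists because the curve is twice derivable. *)
Lemma incompressible_hypercylinder (I : set R) (gamma : R -> 'rV[R]_2) :
  (0 < n)%N -> open I -> twice_derivable I gamma -> unit_speed I gamma ->
  let x := @hypercylinder R n gamma in
  incompressible (induced_metric x) (canonical_field x) (cylinder_domain I)
  <-> forall s, I s ->
    is_derive s 1 (fun t => dot (gamma t) (derive1 gamma t)) (1 - n%:R).
Proof.
move=> n0 oI dg ug x.
have nE : n%:R = 1 + n.-1%:R :> R by rewrite -[in LHS](prednK n0) -natr1 addrC.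
split=> [inc s Is|D u Iu].
  have [d1 d2] := dg s Is.
  have D := is_derive_dot _ _ _ _ _ (derivable_is_derive1 _ _ d1)
    (derivable_is_derive1 _ _ d2).
  apply: (is_derive_eq D); move: D; set d := _ + _ => D.
  pose u : 'rV[R]_(1 + n.-1) := row_mx s%:M 0.
  have us : arclength u = s by exact: arclength_row_mx.
  have := divergence_hypercylinder I _ oI dg ug u d; rewrite us => /(_ Is D) E.
  have := inc u; rewrite /cylinder_domain/= us => /(_ Is); rewrite E.
  by rewrite nE => /eqP; rewrite addr_eq0 => /eqP ->; ring.
rewrite (divergence_hypercylinder I _ oI dg ug _ _ Iu (D _ Iu)).
by rewrite nE; ring.
Qed.

(** Acting on row vectors from the right, this matrix is multiplication by the conjugate a - i b, as
    in [curve_of_incompressible]. *)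
Lemma is_rotation_mx2 (a b : R) : a ^+ 2 + b ^+ 2 = 1 ->
  is_rotation (\matrix_(i < 2, j < 2)
    (if i == j then a else if i == 0 then - b else b)).
Proof.
move=> ab; split; last first.
  rewrite -ab (expand_det_row _ 0) !big_ord_recl big_ord0 !mxE /=.
  by rewrite /cofactor !det_mx11 !mxE /= expr0 expr1; ring.
apply/matrixP => i j; rewrite mxE !big_ord_recl big_ord0 !mxE/=.
by case: i j => [[|[|[]]]//= ?] [[|[|[]]]//= ?]; rewrite /= -?ab; ring.
Qed.

End Hypercylinder.

Theorem theorem5p1 (R : realType) (n : nat) (hn : (2 <= n)%N)
    (I : set R) (Iopen : open I) (Iitv : is_interval I) (Ine : I !=set0)
    (gamma : R -> 'rV[R]_2)
    (gamma_diff : twice_derivable I gamma) (gamma_unit : unit_speed I gamma) :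
  let x := @hypercylinder R n gamma in
  incompressible (induced_metric x) (canonical_field x) (cylinder_domain I)
  <->
  exists2 c : R, 0 < c &
    open_part_up_to_rotation (cylinder_domain I) x
      (cylinder_domain [set s | - c < s < c]) (@model_hypersurface R n c).
Proof.
move=> x; have n0 := ltnW hn.
apply: (iff_trans (incompressible_hypercylinder I gamma n0 Iopen gamma_diff
  gamma_unit)).
have D1 s : I s -> is_derive s 1 gamma (derive1 gamma s).
  by move=> Is; apply: derivable_is_derive1; case: (gamma_diff s Is).
split=> [inc|[c c0 /open_part_hypercylinder[A [e [b [[AA _] e1 H]]]]] s Is].
  have D2 s : I s -> is_derive s 1 (derive1 gamma) (derive1 (derive1 gamma) s).
    by move=> Is; apply: derivable_is_derive1; case: (gamma_diff s Is).
  have [||||||c c0 [e [b [w1 [w2 [e1 w12 H]]]]]] :=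
    curve_of_incompressible n I (fun s => gamma s 0 0) (fun s => gamma s 0 1)
    (fun s => derive1 gamma s 0 0) (fun s => derive1 gamma s 0 1)
    (fun s => derive1 (derive1 gamma) s 0 0)
    (fun s => derive1 (derive1 gamma) s 0 1) hn Iopen Iitv Ine.
  - by move=> s /D1 /is_derive_mxP; exact.
  - by move=> s /D1 /is_derive_mxP; exact.
  - by move=> s /D2 /is_derive_mxP; exact.
  - by move=> s /D2 /is_derive_mxP; exact.
  - by move=> s /gamma_unit; rewrite dot2E !expr2.
  (* The product rule gives f' = <gamma, T'> + <T, T>; unit speed and f' = 1 - n leave <gamma, T'> =
     - n. *)
  - move=> s Is; have [_] := is_derive_dot _ _ _ _ _ (D1 s Is) (D2 s Is).
    have [_ ->] := inc s Is; rewrite gamma_unit// dot2E => E.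
    by rewrite -[LHS](addrK 1) -E; ring.
  exists c => //; apply/open_part_hypercylinder.
  exists (\matrix_(i, j) (if i == j then w1 else if i == 0 then - w2 else w2)).
  exists e, b; split=> //; first exact: is_rotation_mx2.
  move=> s Is; have [tc E0 E1] := H s Is; split=> //.
  have lift01 : lift ord0 ord0 = 1 :> 'I_2 by exact/val_inj.
  apply/rowP => j; have [->|->] : j = 0 \/ j = 1.
  - by case: j => [[|[|[]]]//= ?]; [left|right]; exact/val_inj.
  - by rewrite -E0 mxE big_ord_recl big_ord1 !mxE lift01.
  - by rewrite -E1 mxE big_ord_recl big_ord1 !mxE lift01 /=; ring.
set N : R := n%:R.
have e2 : e * e = 1 by case: e1 => ->; ring.
have gE t : I t -> N * (N - 1) * c ^+ 2 - (N - 1) * (e * t + b) ^+ 2 =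
    dot (gamma t) (gamma t).
  move=> It; have [/= tc E] := H t It.
  by rewrite -(dot_mulmx _ _ _ AA) E dot_model_curve.
have Da (t : R) : is_derive t 1 (e *: (id : R -> R) + cst b) e.
  have D := is_deriveD (is_deriveZ e (is_derive_id t 1)) (is_derive_cst b t 1).
  by apply: is_derive_eq D _; rewrite /GRing.scale/=; ring.
(* Half the derivative of [gE]; e^2 = 1 turns e (e t + b) into t + e b, so f is affine with slope 1
   - N. *)
have dE t : I t -> (1 - N) * (t + e * b) = dot (gamma t) (derive1 gamma t).
  move=> It.
  have Dg := is_derive_dot _ _ _ _ _ (D1 t It) (D1 t It).
  have Dq := is_deriveB (is_derive_cst (N * (N - 1) * c ^+ 2) t 1)
    (is_deriveZ (N - 1) (is_deriveX 2 (Da t))).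
  have [_] := eq_on_open_is_derive I _ _ t _ Iopen It gE Dq.
  case: Dg => _ ->.
  have -> : dot (derive1 gamma t) (gamma t) = dot (gamma t) (derive1 gamma t).
    by rewrite !dot2E; ring.
  rewrite !fctE/= /GRing.scale/= => E.
  apply: (@mulfI _ 2) => //.
  transitivity (dot (gamma t) (derive1 gamma t)
    + dot (gamma t) (derive1 gamma t)); last by ring.
  apply: etrans (esym E).
  transitivity (2 * (1 - N) * (e * e * t + e * b)); last by ring.
  by rewrite e2; ring.
apply: (eq_on_open_is_derive I _ _ s _ Iopen Is dE).
have D := is_deriveZ (1 - N) (is_deriveD (is_derive_id s 1)
  (is_derive_cst (e * b) s 1)).
by apply: is_derive_eq D _; rewrite /GRing.scale/=; ring.
Qed.
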